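(* Let $X_1,\dots,X_p$ be independent random variables, $X_i$ valued in a measurable space $E_i$, let $f:E_1\times\dots\times E_p\to\mathbb R^k$ be measurable, and assume that $Y=f(X_1,\dots,X_p)$ satisfies $\mathbb E(\|Y\|^2)<\infty$ and has positive definite covariance matrix. Let $\mathbf u\subset\{1,\dots,p\}$. Then: 1. for every $k\times k$ real matrix $O$ with $O^tO=\mathrm{Id}_k$, $S^{\mathbf u}(Of)=S^{\mathbf u}(f)$; 2. for every $\lambda\in\mathbb R$ with $\lambda\neq 0$, $S^{\mathbf u}(\lambda f)=S^{\mathbf u}(f)$.
   Context: For $\mathbf u\subset\{1,\dots,p\}$ put $X_{\mathbf u}=(X_i,\ i\in\mathbf u)$. For $f$ and $Y=f(X_1,\dots,X_p)$ as in the claim, $\Sigma$ denotes the covariance matrix of $Y$ and $C_{\mathbf u}$ denotes the covariance matrix of $\mathbb E(Y\mid X_{\mathbf u})$. The generalized Sobol index is $S^{\mathbf u}(f)=\mathrm{Tr}(C_{\mathbf u})/\mathrm{Tr}(\Sigma)$. $Of$ and $\lambda f$ denote the functions $x\mapsto O\,f(x)$ and $x\mapsto\lambda f(x)$; their indices are defined in the same way (same inputs) from the outputs $OY$ and $\lambda Y$. *)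

(* Defs.v *)
From HB Require Import structures.
From mathcomp Require Import all_boot all_order all_algebra.
From mathcomp Require Import all_classical all_reals all_analysis.

Set Implicit Arguments.
Unset Strict Implicit.
Unset Printing Implicit Defensive.

Import Order.TTheory GRing.Theory Num.Theory.
Import numFieldNormedType.Exports.

Local Open Scope classical_set_scope.
Local Open Scope ring_scope.

(* The sets [X_i \in B] with i in u and B measurable: they generate the
   sigma-algebra of X_u = (X_i, i in u). *)
Definition joint_events (T : Type) (p : nat) (d : 'I_p -> measure_display)
    (E : forall i, measurableType (d i)) (u : {set 'I_p})
    (X : forall i, T -> E i) : set (set T) :=
  \bigcup_(i in [set` u]) preimage_set_system setT (X i) measurable.

(* E_1 x ... x E_p with the product sigma-algebra, which is the one generated
   by the coordinate projections. *)
Definition prod_space (p : nat) (d : 'I_p -> measure_display)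
    (E : forall i, measurableType (d i)) :=
  g_sigma_algebraType
    (joint_events [set: 'I_p]%SET (fun i (x : forall j, E j) => x i)).

(* R^k, as column vectors, with its Borel sigma-algebra. *)
Definition borel_cV (R : realType) (k : nat) :=
  g_sigma_algebraType (@open 'cV[R]_k).

(* Euclidean norm (the norm `|v| that the library puts on matrices is the
   max norm). *)
Definition enorm (R : realType) (k : nat) (v : 'cV[R]_k) : R :=
  Num.sqrt (\sum_(i < k) v i 0 ^+ 2).

Definition posdefmx (R : realType) (k : nat) (M : 'M[R]_k) : Prop :=
  M^T = M /\ forall v : 'cV[R]_k, v != 0 -> 0 < (v^T *m M *m v) 0 0.

Section Probability.
Context (dT : measure_display) (T : measurableType dT) (R : realType)
        (P : probability T R).

Definition mutually_independent (p : nat) (d : 'I_p -> measure_display)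
    (E : forall i, measurableType (d i)) (X : forall i, T -> E i) : Prop :=
  forall (J : {set 'I_p}) (B : forall i, set (E i)),
    (forall i, measurable (B i)) ->
    P (\bigcap_(i in [set` J]) (X i @^-1` B i)) =
    (\prod_(i in J) P (X i @^-1` B i))%E.

(* Z is a version of the conditional expectation of Y given <<s G >>. *)
Definition is_cond_exp (G : set (set T)) (Y Z : T -> R) : Prop :=
  [/\ measurable_fun [set: g_sigma_algebraType G] Z,
      P.-integrable setT (EFin \o Z) &
      forall A, <<s G >> A ->
        (\int[P]_(w in A) (Z w)%:E = \int[P]_(w in A) (Y w)%:E)%E].

(* A chosen version; versions exist when Y is integrable and <<s G >> consists
   of measurable sets, and any two of them are equal almost surely. *)
Definition cond_exp (G : set (set T)) (Y : T -> R) : T -> R :=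
  xget (cst 0) [set Z | is_cond_exp G Y Z].

Definition cond_exp_cV (G : set (set T)) (k : nat) (Y : T -> 'cV[R]_k) :
    T -> 'cV[R]_k :=
  fun w => \col_i cond_exp G (fun w' => Y w' i 0) w.

(* [fine] is harmless for square integrable Y, whose covariances are finite. *)
Definition covmx (k : nat) (Y : T -> 'cV[R]_k) : 'M[R]_k :=
  \matrix_(i, j) fine (covariance P (fun w => Y w i 0) (fun w => Y w j 0)).

Definition output (p : nat) (d : 'I_p -> measure_display)
    (E : forall i, measurableType (d i)) (X : forall i, T -> E i) (k : nat)
    (f : prod_space E -> borel_cV R k) : T -> 'cV[R]_k :=
  fun w => f (fun i => X i w).

Definition sobol_index (p : nat) (d : 'I_p -> measure_display)
    (E : forall i, measurableType (d i)) (X : forall i, T -> E i)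
    (u : {set 'I_p}) (k : nat) (f : prod_space E -> borel_cV R k) : R :=
  let Y := output X f in
  \tr (covmx (cond_exp_cV (joint_events u X) Y)) / \tr (covmx Y).

End Probability.

(* Main.v *)
(* Both parts are the case of a square matrix M with M^T M = c Id and c != 0
   (M = O with c = 1, and M = lambda Id with c = lambda^2).  Conditional
   expectation commutes with M up to null sets, so that both covariance matrices
   are transformed by C |-> M C M^T and both traces are multiplied by c.

   Existence of a version of E(Y | G) is the Radon-Nikodym theorem for the
   restriction of P to <<s G >>, obtained as the image of P by the identity
   T -> g_sigma_algebraType G.  Bilinearity of the covariance requires
   Z = E(Y | G) to be square integrable when Y is: on the event
   {a <= Z < a + 1}, a an integer, Z^2 <= 2aZ - a^2 + 1 and
   2aY - a^2 <= Y^2, hence the integral of Z^2 is at most that of Y^2 + 1. *)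

Require Import Defs.
From HB Require Import structures.
From mathcomp Require Import all_boot all_order all_algebra.
From mathcomp Require Import all_classical all_reals all_analysis.
From mathcomp Require Import measurable_realfun.
From mathcomp Require Import ring.

Set Implicit Arguments.
Unset Strict Implicit.
Unset Printing Implicit Defensive.

Import Order.TTheory GRing.Theory Num.Theory.
Import numFieldNormedType.Exports.

Local Open Scope classical_set_scope.
Local Open Scope ring_scope.

(** * Conditional expectation given a generated sigma-algebra: existence, uniqueness, linearity *)

Section cond_exp_theory.
Context (d : measure_display) (T : measurableType d) (R : realType)
        (P : probability T R).
Context (G : set (set T)) (mG : G `<=` measurable).

Lemma sub_sigma_measurable (A : set T) : <<s G >> A -> measurable A.
Proof. exact: (smallest_sub (@sigma_algebra_measurable _ T) mG). Qed.

Lemma measurable_id_g_sigma :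
  measurable_fun [set: T] (idfun : T -> g_sigma_algebraType G).
Proof.
by move=> _ A mA; rewrite setTI preimage_id; exact: sub_sigma_measurable.
Qed.

Lemma sub_sigma_measurable_fun (Z : T -> R) :
  measurable_fun [set: g_sigma_algebraType G] Z -> measurable_fun [set: T] Z.
Proof.
by move=> mZ; exact: (measurableT_comp mZ measurable_id_g_sigma).
Qed.

Let idG : {mfun T >-> g_sigma_algebraType G} :=
  HB.pack (idfun : T -> g_sigma_algebraType G)
    (@isMeasurableFun.Build _ _ _ _ _ measurable_id_g_sigma).

Let Q : probability (g_sigma_algebraType G) R := distribution P idG.

Lemma is_cond_exp_exists (Y : T -> R) :
  P.-integrable [set: T] (EFin \o Y) -> exists Z, is_cond_exp P G Y Z.
Proof.
(* [nu] is the signed measure sending A to the integral of [Y] over A, for A in [<<s G >>]. *)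
move=> iY; pose nu := pushforward (induced_charge iY) idG.
have nuQ : nu `<< Q.
  apply/null_content_dominatesP => A mA QA0.
  apply: null_set_integral => //.
  - exact: sub_sigma_measurable.
  - apply: (measurable_funS measurableT) => //.
    exact: (measurable_int P).
(* A real-valued density, for an arbitrary charge: the charge structure of [nu] rests on the
   measurability of the identity, which is supplied when [RN] is applied. *)
have RN (mu : {charge set (g_sigma_algebraType G) -> \bar R}) : mu `<< Q ->
    exists2 Z : T -> R, Q.-integrable setT (EFin \o Z) &
      forall A, <<s G >> A -> mu A = (\int[Q]_(w in A) (Z w)%:E)%E.
  move=> muQ; exists (fun w => fine (Radon_Nikodym mu Q w)).
  - rewrite (_ : _ \o _ = Radon_Nikodym mu Q).
      exact: Radon_Nikodym_integrable.
    by apply/funext => w /=; rewrite fineK// Radon_Nikodym_fin_num.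
  - move=> A mA; rewrite (Radon_Nikodym_integral muQ mA).
    by apply: eq_integral => w _; rewrite fineK// Radon_Nikodym_fin_num.
unshelve epose proof (RN _ nuQ) as [Z iZ nuE].
  exact: measurable_id_g_sigma.
have mZ : measurable_fun [set: g_sigma_algebraType G] Z.
  by apply/measurable_EFinP; exact: (measurable_int _ iZ).
have iZP : P.-integrable [set: T] (EFin \o Z).
  apply/integrableP; split.
    by apply/measurable_EFinP; exact: sub_sigma_measurable_fun.
  have /integrableP[_] := iZ.
  rewrite (@ge0_integral_pushforward _ _ _ _ _ idG)//.
  by apply: measurableT_comp => //; exact/measurable_EFinP.
exists Z; split => // A GA; rewrite [RHS](nuE _ GA).
rewrite (integral_pushforward measurable_id_g_sigma)//.
- exact/measurable_EFinP.
- by apply: integrableS iZP => //; exact: sub_sigma_measurable.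
Qed.

(** Both versions are measurable for [<<s G >>] and have the same integrals over its sets, hence
    agree outside a [Q]-null set; that set is also measurable in [T] and [P]-null. *)
Lemma is_cond_exp_unique (Y Z Z' : T -> R) :
  is_cond_exp P G Y Z -> is_cond_exp P G Y Z' ->
  {ae P, forall w, Z w = Z' w}.
Proof.
move=> [mZ iZ eZ] [mZ' iZ' eZ'].
have mZe := (measurable_EFinP _ _).2 mZ.
have mZ'e := (measurable_EFinP _ _).2 mZ'.
have : ae_eq Q [set: g_sigma_algebraType G] (EFin \o Z) (EFin \o Z').
  apply: integral_ae_eq => //.
  - exact: (integrable_pushforward measurable_id_g_sigma).
  - move=> A _ mA; have mAT := sub_sigma_measurable mA.
    rewrite !(integral_pushforward measurable_id_g_sigma)//=.
    + by rewrite eZ// eZ'.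
    + exact: integrableS iZ'.
    + exact: integrableS iZ.
move=> [N [mN QN sN]]; exists N; split => //.
  exact: sub_sigma_measurable.
move=> w /= nZ; apply: sN => /= /(_ I) [ZZ']; exact: nZ.
Qed.

(** Since a version exists, the choice does not fall back on its default [cst 0]. *)
Lemma cond_expP (Y : T -> R) :
  P.-integrable [set: T] (EFin \o Y) -> is_cond_exp P G Y (cond_exp P G Y).
Proof.
by move=> /is_cond_exp_exists[Z YZ]; exact: (xgetPex (cst 0) (ex_intro _ Z YZ)).
Qed.

(** Linearity of the integral on each set of [<<s G >>]. Finite sums are used because each
    coordinate of [M *m Y] is one. *)
Lemma is_cond_exp_lincomb (I : Type) (s : seq I) (a : I -> R)
    (Y Z : I -> T -> R) :
  (forall i, P.-integrable [set: T] (EFin \o Y i)) ->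
  (forall i, is_cond_exp P G (Y i) (Z i)) ->
  is_cond_exp P G (fun w => \sum_(i <- s) a i * Y i w)
                  (fun w => \sum_(i <- s) a i * Z i w).
Proof.
move=> iY YZ.
have iaW (W : I -> T -> R) i : P.-integrable [set: T] (EFin \o W i) ->
    P.-integrable [set: T] (fun w => (a i * W i w)%:E).
  move=> iW; rewrite (_ : (fun _ => _) = (fun w => (a i)%:E * (W i w)%:E)%E).
    exact: integrableZl.
  by apply/funext => w; rewrite EFinM.
have iZ i : P.-integrable [set: T] (EFin \o Z i) by case: (YZ i).
have intE (W : I -> T -> R) A : measurable A ->
    (forall i, P.-integrable [set: T] (EFin \o W i)) ->
    (\int[P]_(w in A) (\sum_(i <- s) a i * W i w)%:E =
     \sum_(i <- s) (a i)%:E * \int[P]_(w in A) (W i w)%:E)%E.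
  move=> mA iW; under eq_integral do rewrite -sumEFin.
  rewrite integral_sum//; last first.
    by move=> i; apply: integrableS (iaW _ _ (iW i)).
  apply: eq_bigr => i _; under eq_integral do rewrite EFinM.
  by rewrite integralZl//; exact: integrableS (iW i).
split.
- by apply: measurable_sum => i; apply: measurable_funM => //; case: (YZ i).
- rewrite (_ : _ \o _ = (fun w => \sum_(i <- s) (a i * Z i w)%:E)%E).
    by apply: integrable_sum => // i _; exact: iaW.
  by apply/funext => w /=; rewrite sumEFin.
- move=> A GA; have mA := sub_sigma_measurable GA.
  rewrite !intE//; apply: eq_bigr => i _; congr (_ * _)%E.
  by case: (YZ i) => _ _; exact.
Qed.

End cond_exp_theory.

(** * Square integrable variables: covariance matrices, and stability under conditional
    expectation *)

Section square_integrable.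
Context (d : measure_display) (T : measurableType d) (R : realType)
        (P : probability T R).

Lemma Lfun2P (f : T -> R) :
  f \in Lfun P 2%:E <->
  measurable_fun [set: T] f /\ (\int[P]_w (f w ^+ 2)%:E < +oo)%E.
Proof.
split=> [f2|[mf f2]].
  split; last exact: integrable_lty (Lfun2_integrable_sqr f2).
  by move: f2; rewrite inE => /andP[/[!inE]].
rewrite inE; apply/andP; split; rewrite inE//=.
rewrite /finite_norm unlock poweR_lty//.
by under eq_integral do
  rewrite abse_EFin poweR_EFin powR_mulrn// real_normK ?num_real//.
Qed.

Lemma Lfun2_integrable (f : T -> R) :
  f \in Lfun P 2%:E -> P.-integrable [set: T] (EFin \o f).
Proof.
by move=> /Lfun_subset12 f1; apply/Lfun1_integrable/f1; exact: fin_num_measure.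
Qed.

Lemma Lfun2_lincomb (I : Type) (s : seq I) (a : I -> R) (f : I -> T -> R) :
  (forall i, f i \in Lfun P 2%:E) ->
  (fun w => \sum_(i <- s) a i * f i w) \in Lfun P 2%:E.
Proof.
move=> f2; elim: s => [|i s IH].
  by under eq_fun do rewrite big_nil; exact: Lfun_cst.
under eq_fun do rewrite big_cons.
rewrite (_ : (fun _ => _) =
    (a i \o* f i + (fun w => \sum_(j <- s) a j * f j w)))%R; last first.
  by apply/funext => w; rewrite !fctE /= mulrC.
by rewrite rpredD ?lee1n//= Lfun_scale// ler1n.
Qed.

Lemma covariance_fin_num2 (f g : T -> R) :
  f \in Lfun P 2%:E -> g \in Lfun P 2%:E -> covariance P f g \is a fin_num.
Proof.
move=> f2 g2; have PT := fin_num_measure P _ measurableT.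
by rewrite covariance_fin_num ?Lfun2_mul_Lfun1 ?(Lfun_subset12 PT).
Qed.

(** Square integrability keeps every covariance finite, so that [fine] commutes with the sums and
    products met in the induction. *)
Lemma covariance_lincombl (I : Type) (s : seq I) (a : I -> R)
    (f : I -> T -> R) (g : T -> R) :
  (forall i, f i \in Lfun P 2%:E) -> g \in Lfun P 2%:E ->
  fine (covariance P (fun w => \sum_(i <- s) a i * f i w) g) =
  \sum_(i <- s) a i * fine (covariance P (f i) g).
Proof.
move=> f2 g2; have PT := fin_num_measure P _ measurableT.
elim: s => [|i s IH].
  rewrite big_nil; under eq_fun do rewrite big_nil.
  by rewrite covariance_cst_l.
rewrite big_cons -IH; under eq_fun do rewrite big_cons.
rewrite (_ : (fun _ => _) =
    (a i \o* f i \+ (fun w => \sum_(j <- s) a j * f j w))); last first.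
  by apply/funext => w /=; rewrite mulrC.
have af2 : a i \o* f i \in Lfun P 2%:E by rewrite Lfun_scale// ler1n.
have sf2 := Lfun2_lincomb s a f2.
rewrite covarianceDl// fineD ?covariance_fin_num2//.
rewrite covarianceZl ?Lfun2_mul_Lfun1 ?(Lfun_subset12 PT)//.
by rewrite fineM// covariance_fin_num2.
Qed.

Lemma covmx_mul (m k : nat) (M : 'M[R]_(m, k)) (Y : T -> 'cV[R]_k) :
  (forall i, (fun w => Y w i 0) \in Lfun P 2%:E) ->
  covmx P (fun w => M *m Y w) = M *m covmx P Y *m M^T.
Proof.
move=> Y2; apply/matrixP => i j; rewrite !mxE.
have ME l : (fun w => (M *m Y w) l 0) =
    (fun w => \sum_(n < k) M l n * Y w n 0).
  by apply/funext => w; rewrite mxE.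
rewrite !ME covariance_lincombl//; last exact: Lfun2_lincomb.
(* Symmetry of the covariance turns linearity on the left into linearity on the right. *)
under eq_bigr do rewrite covarianceC covariance_lincombl// mulr_sumr.
rewrite exchange_big/=; apply: eq_bigr => n _; rewrite !mxE mulr_suml.
by apply: eq_bigr => l _; rewrite !mxE covarianceC; ring.
Qed.

(** By cyclicity of the trace, tr (M C M^T) = tr (M^T M C) = c tr C. *)
Lemma tr_covmx_mul (k : nat) (M : 'M[R]_k) (c : R) (Y : T -> 'cV[R]_k) :
  M^T *m M = c%:M -> (forall i, (fun w => Y w i 0) \in Lfun P 2%:E) ->
  \tr (covmx P (fun w => M *m Y w)) = c * \tr (covmx P Y).
Proof.
move=> MM Y2.
by rewrite covmx_mul// mxtrace_mulC mulmxA MM mul_scalar_mx mxtraceZ.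
Qed.

(** Makes the covariance matrix of a conditional expectation independent of the chosen version. *)
Lemma covmx_ae_eq (k : nat) (Y Z : T -> 'cV[R]_k) :
  (forall i, measurable_fun [set: T] (fun w => Y w i 0)) ->
  (forall i, measurable_fun [set: T] (fun w => Z w i 0)) ->
  (forall i, {ae P, forall w, Y w i 0 = Z w i 0}) ->
  covmx P Y = covmx P Z.
Proof.
move=> mY mZ YZ; apply/matrixP => i j; rewrite !mxE; congr fine.
(* The means are compared first, since the covariance is an integral of centered variables. *)
have EE l : 'E_P[fun w => Y w l 0%R]%E = 'E_P[fun w => Z w l 0%R]%E.
  rewrite unlock; apply: ae_eq_integral => //; try exact/measurable_EFinP.
  by apply: filterS (YZ l) => w -> _.
rewrite !covariance.unlock !EE expectation.unlock.
apply: ae_eq_integral => //.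
- apply/measurable_EFinP; apply: measurable_funM; exact: measurable_funB.
- apply/measurable_EFinP; apply: measurable_funM; exact: measurable_funB.
- by apply: filterS2 (YZ i) (YZ j) => w Yi Yj _; rewrite /= !fctE /= Yi Yj.
Qed.

Lemma is_cond_exp_Lfun2 (G : set (set T)) (Y Z : T -> R) :
  G `<=` measurable -> Y \in Lfun P 2%:E -> is_cond_exp P G Y Z ->
  Z \in Lfun P 2%:E.
Proof.
move=> mG Y2 [mZG iZ ZY].
have mZ := sub_sigma_measurable_fun mG mZG.
have [mY Y2oo] := (Lfun2P Y).1 Y2; have iY := Lfun2_integrable Y2.
(* [pickle] numbers the integers by naturals: [F n] is the event that the floor of [Z] is the
   integer of code n, and is empty if n codes no integer. *)
pose F n := Z @^-1` [set x | pickle (Num.floor x) = n].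
have mF n : <<s G >> (F n).
  rewrite -[F n]setTI; apply: mZG => //.
  have [[x xn]|nx] := pselect (exists x : R, pickle (Num.floor x) = n).
    rewrite (_ : [set _ | _] =
      `[(Num.floor x)%:~R, (Num.floor x + 1)%:~R[%classic).
      exact: measurable_itv.
    apply/seteqP; split => y /=; rewrite in_itv/=.
      by rewrite -xn => /(pcan_inj pickleK) <-; exact: floor_itv.
    by move=> /floor_def ->.
  rewrite (_ : [set _ | _] = set0)//; apply/seteqP; split => // y yn.
  by apply: nx; exists y.
have mFT n : measurable (F n) by exact: (sub_sigma_measurable mG).
have tF : trivIset setT F.
  apply/trivIsetP => i j _ _ /eqP ij; apply/seteqP; split => // w [iw jw].
  by apply: ij; rewrite -iw -jw.
have UF : \bigcup_n F n = [set: T].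
  by apply/seteqP; split => // w _; exists (pickle (Num.floor (Z w))).
have mZ2 : measurable_fun setT (fun w => (Z w ^+ 2)%:E).
  by apply/measurable_EFinP; exact: measurable_funX.
have mY2 : measurable_fun setT (fun w => (Y w ^+ 2)%:E).
  by apply/measurable_EFinP; exact: measurable_funX.
have mY21 : measurable_fun setT (fun w => (Y w ^+ 2 + 1)%:E).
  apply/measurable_EFinP; apply: measurable_funD => //.
  exact: measurable_funX.
(* The tangent at a, raised by 1. Its integral over A depends on [W] only through the integral of
   [W] over A, so it is the same for [Z] and [Y] when A is [F n]. *)
have aff (W : T -> R) (A : set T) (a : R) : measurable A ->
    P.-integrable setT (EFin \o W) ->
    (P.-integrable A (fun w => (a *+ 2 * W w + (1 - a ^+ 2))%:E) /\
    \int[P]_(w in A) (a *+ 2 * W w + (1 - a ^+ 2))%:E =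
    (a *+ 2)%:E * \int[P]_(w in A) (W w)%:E + (1 - a ^+ 2)%:E * P A)%E.
  move=> mA iW; have iWA : P.-integrable A (EFin \o W) by exact: integrableS iW.
  have iaW : P.-integrable A (fun w => (a *+ 2)%:E * (W w)%:E)%E.
    exact: integrableZl.
  have ic : P.-integrable A (cst (1 - a ^+ 2)%:E).
    by apply: finite_measure_integrable_cst.
  split.
    rewrite (_ : (fun _ => _) =
      (fun w => (a *+ 2)%:E * (W w)%:E + cst (1 - a ^+ 2)%:E w)%E).
      exact: integrableD.
    by apply/funext => w; rewrite EFinD EFinM.
  under eq_integral do rewrite EFinD EFinM.
  by rewrite integralD// integralZl// integral_cst.
have bound n :
    (\int[P]_(w in F n) (Z w ^+ 2)%:E <=
     \int[P]_(w in F n) (Y w ^+ 2 + 1)%:E)%E.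
  have [->|/set0P[w0 Fw0]] := eqVneq (F n) set0.
    by rewrite !integral_set0.
  pose a : R := (Num.floor (Z w0))%:~R.
  have aZ w : F n w -> a <= Z w < a + 1.
    rewrite /F /= -Fw0 => /(pcan_inj pickleK) eqa.
    by have := floor_itv (Z w); rewrite eqa intrD.
  have [iaZ eaZ] := aff Z (F n) a (mFT n) iZ.
  have [iaY eaY] := aff Y (F n) a (mFT n) iY.
  apply: (@le_trans _ _
      (\int[P]_(w in F n) (a *+ 2 * Z w + (1 - a ^+ 2))%:E)%E).
    apply: ge0_le_integral => //.
    - by move=> w _; rewrite lee_fin sqr_ge0.
    - exact: measurable_funTS.
    - exact: measurable_int iaZ.
    - move=> w /aZ /andP[aw wa]; rewrite lee_fin -subr_ge0.
      (* The gap between the raised tangent and the parabola, written with factors that are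
         nonnegative on [F n]. *)
      rewrite (_ : _ - _ = (Z w - a) * (a + 1 - Z w) + (a + 1 - Z w)).
        by rewrite addr_ge0 ?mulr_ge0// ?subr_ge0// ltW.
      by ring.
  rewrite eaZ ZY// -eaY; apply: le_integral => //.
    have Y21 : P.-integrable setT (fun w => (Y w ^+ 2 + 1)%:E).
      rewrite (_ : (fun _ => _) = (fun w => (Y w ^+ 2)%:E + cst 1%:E w)%E)//.
      apply: integrableD => //; first exact: Lfun2_integrable_sqr.
      exact: finite_measure_integrable_cst.
    exact: integrableS Y21.
  move=> w _; rewrite lee_fin -subr_ge0.
  by rewrite (_ : _ - _ = (Y w - a) ^+ 2) ?sqr_ge0//; ring.
apply/Lfun2P; split => //.
(* The added 1 contributes only the total mass of [P], which is finite. *)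
apply: (@le_lt_trans _ _ (\int[P]_w (Y w ^+ 2 + 1)%:E)%E); last first.
  under eq_integral do rewrite EFinD.
  rewrite ge0_integralD//=; last by move=> w _; rewrite lee_fin sqr_ge0.
  rewrite integral_cst// mul1e lte_add_pinfty// -ge0_fin_numE//.
  exact: fin_num_measure.
have intF (h : T -> \bar R) : measurable_fun setT h -> (forall w, 0 <= h w)%E ->
    (\int[P]_w h w = \sum_(0 <= n <oo) \int[P]_(w in F n) h w)%E.
  by move=> mh h0; rewrite -UF ge0_integral_bigcup ?UF.
rewrite !intF//; [|by move=> w; rewrite lee_fin ?addr_ge0 ?sqr_ge0..].
apply: lee_nneseries => // n _ _.
by apply: integral_ge0 => w _; rewrite lee_fin sqr_ge0.
Qed.

End square_integrable.

(** * Effect of a matrix on the trace of the covariance of a conditional expectation *)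

Section trace_invariance.
Context (d : measure_display) (T : measurableType d) (R : realType)
        (P : probability T R).

(** The chosen version for [M *m Y] and the image by [M] of the chosen version for [Y] are two
    versions of the same conditional expectation, so they agree almost surely, which suffices for
    covariances. *)
Lemma tr_covmx_cond_exp_mul (G : set (set T)) (k : nat) (M : 'M[R]_k) (c : R)
    (Y : T -> 'cV[R]_k) :
  G `<=` measurable -> M^T *m M = c%:M ->
  (forall i, (fun w => Y w i 0) \in Lfun P 2%:E) ->
  \tr (covmx P (cond_exp_cV P G (fun w => M *m Y w))) =
  c * \tr (covmx P (cond_exp_cV P G Y)).
Proof.
move=> mG MM Y2.
have iY i : P.-integrable [set: T] (EFin \o (fun w => Y w i 0)).
  exact: Lfun2_integrable.
pose Z i := cond_exp P G (fun w => Y w i 0).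
have YZ i : is_cond_exp P G (fun w => Y w i 0) (Z i) by exact: cond_expP.
have Z2 i : Z i \in Lfun P 2%:E by exact: is_cond_exp_Lfun2 (YZ i).
have MY2 i := Lfun2_lincomb (index_enum 'I_k) (M i) Y2.
have MYZ i := is_cond_exp_lincomb mG (index_enum 'I_k) (M i) iY YZ.
have MYE i : (fun w => (M *m Y w) i 0) = (fun w => \sum_j M i j * Y w j 0).
  by apply/funext => w; rewrite mxE.
have MYC i : is_cond_exp P G (fun w => \sum_j M i j * Y w j 0)
    (cond_exp P G (fun w => \sum_j M i j * Y w j 0)).
  by apply: cond_expP => //; exact: Lfun2_integrable.
have mC (W W' : T -> R) : is_cond_exp P G W W' -> measurable_fun [set: T] W'.
  by case=> + _ _; exact: sub_sigma_measurable_fun.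
rewrite -(tr_covmx_mul MM); last first.
  move=> i; rewrite (_ : (fun w => _) = Z i)//.
  by apply/funext => w; rewrite mxE.
have ME i : (fun w => (M *m cond_exp_cV P G Y w) i 0) =
    (fun w => \sum_j M i j * Z j w).
  by apply/funext => w; rewrite mxE; apply: eq_bigr => j _; rewrite mxE.
have CE i : (fun w => cond_exp_cV P G (fun w => M *m Y w) w i 0) =
    cond_exp P G (fun w => \sum_j M i j * Y w j 0).
  by apply/funext => w; rewrite mxE MYE.
congr mxtrace; apply: covmx_ae_eq => i.
- by rewrite CE; exact: mC (MYC i).
- by rewrite ME; exact: mC (MYZ i).
- apply: filterS (is_cond_exp_unique mG (MYC i) (MYZ i)) => w.
  by rewrite -(congr1 (@^~ w) (CE i)) -(congr1 (@^~ w) (ME i)).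
Qed.

End trace_invariance.

(** * Measurability and square integrability of the output; scaling of the Sobol index *)

Lemma measurable_coord_cV (R : realType) (k : nat) (i : 'I_k) :
  measurable_fun [set: borel_cV R k] (fun v : borel_cV R k => v i 0 : R).
Proof.
(* Open intervals generate the Borel sets of the line; their preimages under a coordinate are open
   by continuity. *)
apply: (measurability _ (RGenOpens.measurableE R)).
move=> _ [_ [a [b ->]] <-]; rewrite setTI; apply: sub_sigma_algebra.
by apply: open_comp => // v _; exact: coord_continuous.
Qed.

Section output_theory.
Context (dT : measure_display) (T : measurableType dT) (R : realType)
        (P : probability T R) (p : nat) (d : 'I_p -> measure_display)
        (E : forall i, measurableType (d i)) (X : forall i, {RV P >-> E i}).

Lemma joint_events_measurable (u : {set 'I_p}) :
  joint_events u X `<=` measurable.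
Proof. by move=> A [i _ [B mB <-]]; exact: (measurable_funP (X i)). Qed.

(** It suffices to test the generators of the product sigma-algebra, whose preimages are events of a
    single [X i]. *)
Lemma measurable_inputs :
  measurable_fun [set: T] (fun w => (fun i => X i w) : prod_space E).
Proof.
apply: (@measurability _ _ T (prod_space E) _ _
  (joint_events [set: 'I_p]%SET (fun i (x : forall j, E j) => x i)) erefl)
  => A [B [i _ [C mC <-]] <-].
rewrite !setTI -[X in measurable X]setTI; exact: (measurable_funP (X i)).
Qed.

Lemma measurable_output (k : nat) (f : prod_space E -> borel_cV R k)
    (i : 'I_k) :
  measurable_fun [set: prod_space E] f ->
  measurable_fun [set: T] (fun w => output X f w i 0).
Proof.
move=> mf; apply: (measurableT_comp (measurable_coord_cV i)).
exact: (measurableT_comp mf measurable_inputs).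
Qed.

Lemma Lfun2_output (k : nat) (f : prod_space E -> borel_cV R k) (i : 'I_k) :
  measurable_fun [set: prod_space E] f ->
  ('E_P[fun w => (enorm (output X f w) ^+ 2)%R] < +oo)%E ->
  (fun w => output X f w i 0) \in Lfun P 2%:E.
Proof.
move=> mf Y2; apply/Lfun2P; split; first exact: measurable_output.
have mY j := measurable_output j mf.
have nE w : enorm (output X f w) ^+ 2 = \sum_j output X f w j 0 ^+ 2.
  by rewrite sqr_sqrtr// sumr_ge0// => j _; exact: sqr_ge0.
apply: le_lt_trans Y2; rewrite unlock.
apply: ge0_le_integral => //.
- by move=> w _; rewrite lee_fin sqr_ge0.
- by apply/measurable_EFinP; exact: measurable_funX.
- apply/measurable_EFinP; under eq_fun do rewrite nE.
  by apply: measurable_sum => j; exact: measurable_funX.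
(* The square of one coordinate is dominated by the squared Euclidean norm. *)
- move=> w _; rewrite lee_fin nE (bigD1 i)//= lerDl sumr_ge0// => j _.
  exact: sqr_ge0.
Qed.

Lemma sobol_index_mul (u : {set 'I_p}) (k : nat)
    (f : prod_space E -> borel_cV R k) (M : 'M[R]_k) (c : R) :
  measurable_fun [set: prod_space E] f ->
  ('E_P[fun w => (enorm (output X f w) ^+ 2)%R] < +oo)%E ->
  c != 0 -> M^T *m M = c%:M ->
  sobol_index P X u (fun x => M *m f x) = sobol_index P X u f.
Proof.
move=> mf Y2 c0 MM; have Y2i i := Lfun2_output i mf Y2.
rewrite /sobol_index.
rewrite (tr_covmx_cond_exp_mul (@joint_events_measurable u) MM Y2i).
(* The factor [c] of the numerator cancels that of the denominator. *)
by rewrite (tr_covmx_mul MM Y2i) -mulf_div divff// mul1r.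
Qed.

End output_theory.

Theorem proposition3p1 (R : realType) (dT : measure_display)
    (T : measurableType dT) (P : probability T R)
    (p : nat) (d : 'I_p -> measure_display)
    (E : forall i, measurableType (d i))
    (X : forall i, {RV P >-> E i})
    (X_indep : mutually_independent P X)
    (k : nat) (f : prod_space E -> borel_cV R k)
    (f_meas : measurable_fun [set: prod_space E] f)
    (Y_L2 : ('E_P[fun w => (enorm (output X f w) ^+ 2)%R] < +oo)%E)
    (Y_posdef : posdefmx (covmx P (output X f)))
    (u : {set 'I_p}) :
  (forall O : 'M[R]_k, O^T *m O = 1%:M ->
     sobol_index P X u (fun x => O *m f x) = sobol_index P X u f)
  /\
  (forall lambda : R, lambda != 0 ->
     sobol_index P X u (fun x => lambda *: f x) = sobol_index P X u f).
Proof.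
split=> [A AA|l l0].
  by apply: (@sobol_index_mul _ _ _ _ _ _ _ _ _ _ _ _ 1) => //;
    rewrite oner_neq0.
under eq_fun do rewrite -mul_scalar_mx.
apply: (@sobol_index_mul _ _ _ _ _ _ _ _ _ _ _ _ (l ^+ 2)) => //.
- by rewrite expf_neq0.
- by rewrite tr_scalar_mx -scalar_mxM.
Qed.
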